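(* Let $X$ be a locally compact Polish space and let $\mathcal{G} = \{\operatorname{Iso}(X,d) : d \in \operatorname{Metr}_c(X)\}$. Then for any nonempty family $\mathcal{F} \subset \mathcal{G}$, $\bigcap \mathcal{F} \in \mathcal{G}$.
   Context: A space is Polish if it is separable and completely metrizable. A metric is proper if all closed balls with respect to it are compact. $\operatorname{Metr}_c(X)$ is the set of all proper metrics on $X$ inducing the topology of $X$. $\operatorname{Iso}(X,d)$ is the group of all bijective isometries of $(X,d)$. *)

(* Defs.v *)
From mathcomp Require Import all_boot all_order all_algebra.
From mathcomp Require Import all_classical all_reals all_analysis.
Import Order.TTheory GRing.Theory Num.Theory.
Import numFieldNormedType.Exports.

Set Implicit Arguments.
Unset Strict Implicit.
Unset Printing Implicit Defensive.

Local Open Scope classical_set_scope.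
Local Open Scope ring_scope.

(* Metrics are functions rather than [metricType] structures: many metrics on
   the same topological space have to be considered simultaneously. *)
Definition is_metric (R : realType) (T : Type) (d : T -> T -> R) : Prop :=
  [/\ forall x y, 0 <= d x y,
      forall x y, d x y = 0 <-> x = y,
      forall x y, d x y = d y x
    & forall x y z, d x z <= d x y + d y z].

Definition complete_metric (R : realType) (T : Type) (d : T -> T -> R) : Prop :=
  forall u : nat -> T,
    (forall e : R, 0 < e ->
      exists N : nat, forall m n : nat,
        (N <= m)%N -> (N <= n)%N -> d (u m) (u n) < e) ->
    exists l : T, d (u n) l @[n --> \oo] --> (0 : R).

Definition induces_topology (R : realType) (X : topologicalType)
    (d : X -> X -> R) : Prop :=
  forall U : set X, open U <->
    forall x, U x -> exists2 e : R, 0 < e & [set y | d x y < e] `<=` U.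

Definition separable (X : topologicalType) : Prop :=
  exists2 S : set X, countable S & dense S.

Definition completely_metrizable (R : realType) (X : topologicalType) : Prop :=
  exists d : X -> X -> R,
    [/\ is_metric d, induces_topology d & complete_metric d].

Definition polish (R : realType) (X : topologicalType) : Prop :=
  separable X /\ completely_metrizable R X.

(* Compactness refers to the topology of [X]; this is compactness with respect
   to [d] whenever [induces_topology d] holds, as in [Metr_c]. *)
Definition proper_metric (R : realType) (X : topologicalType)
    (d : X -> X -> R) : Prop :=
  forall (x : X) (r : R), 0 < r -> compact [set y | d x y <= r].

Definition Metr_c (R : realType) (X : topologicalType) : set (X -> X -> R) :=
  [set d | [/\ is_metric d, induces_topology d & proper_metric d]].
Arguments Metr_c : clear implicits.

(* An isometry group is represented by its underlying set of maps; the group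
   law is always composition, so equality of groups is equality of sets. *)
Definition Iso (R : realType) (X : Type) (d : X -> X -> R) : set (X -> X) :=
  [set f | bijective f /\ forall x y, d (f x) (f y) = d x y].

Definition Iso_groups (R : realType) (X : topologicalType) :
    set (set (X -> X)) :=
  [set Iso d | d in Metr_c R X].
Arguments Iso_groups : clear implicits.

(* Main.v *)
Require Import Defs.
From mathcomp Require Import all_boot all_order all_algebra.
From mathcomp Require Import all_classical all_reals all_analysis.
From mathcomp Require Import lra.
Import Order.TTheory GRing.Theory Num.Theory.
Import numFieldNormedType.Exports.

Local Open Scope classical_set_scope.
Local Open Scope ring_scope.

(* Let G be the intersection and d0 one of the given metrics. Among the
   G-invariant metrics d >= d0 that are continuous for d0 (all of them are proper
   and induce the topology) a generic one, in the sense of Baire, has no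
   isometries outside G. Write O(x, y) for the closed G-orbit of the unordered
   pair {x, y}. Generically, d takes distinct values on distinct orbits
   O(x, y) and O(a, b) with x, y, a, b in a countable dense set. If O(x, y) is
   not isolated, an arbitrarily small G-invariant bump centred at O(x, y), steep
   compared with d, has a drop that an isometry u can reproduce at (u x, u y)
   only if (u x, u y) is close to O(x, y); so generically u preserves O(x, y) for
   x, y in the dense set. If O(x, y) is isolated, the inverse of u maps pairs
   (a, b) of the dense set near (u x, u y) into O(x, y), so that
   d(a, b) = d(x, y) and O(a, b) = O(x, y). In both cases every given metric
   takes the same value at (x, y) and (u x, u y). *)
Section Metrics.
Set Implicit Arguments.
Unset Strict Implicit.
Variables (R : realType) (X : Type).
Implicit Types (d f : X -> X -> R) (x y a b : X).

(** * Comparison of metrics and elementary inequalities *)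

Definition metric_continuous d f : Prop :=
  forall x (e : R), 0 < e ->
    exists2 r : R, 0 < r & forall y, d x y < r -> f x y < e.

Lemma metric0 d x : is_metric d -> d x x = 0.
Proof. by case=> _ d0 _ _; apply/d0. Qed.

Lemma metric_gt0 d x y : is_metric d -> x <> y -> 0 < d x y.
Proof.
case=> dge d0 _ _ xy; rewrite lt_neqAle dge andbT eq_sym.
by apply/eqP => /d0.
Qed.

Lemma metric_quad d a b a' b' : is_metric d ->
  d a b <= d a a' + d a' b' + d b b'.
Proof.
case=> _ _ dC dT.
have := dT a a' b; have := dT a' b' b; rewrite (dC b' b); lra.
Qed.

(** * Distance to the orbit of a pair of points *)

Section GroupAction.
Variable G : set (X -> X).
Hypothesis G_id : G id.
Hypothesis G_comp : forall g h, G g -> G h -> G (g \o h).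
Hypothesis G_inv : forall g, G g ->
  exists2 h, G h & cancel g h /\ cancel h g.

Definition invariant_metric d : Prop :=
  is_metric d /\ forall g, G g -> forall x y, d (g x) (g y) = d x y.

(* The distance from [(a, b)] to the [G]-orbit of the unordered pair
   [{x, y}]. *)
Definition orbit_dist d x y a b : R :=
  inf [set r | exists2 g, G g &
    r = d a (g x) + d b (g y) \/ r = d b (g x) + d a (g y)].

Lemma le_orbit_dist d x y a b c :
  (forall g, G g -> c <= d a (g x) + d b (g y)) ->
  (forall g, G g -> c <= d b (g x) + d a (g y)) ->
  c <= orbit_dist d x y a b.
Proof.
move=> h1 h2; apply: lb_le_inf.
  by exists (d a x + d b y), id => //; left.
by move=> r [g Gg [->|->]]; [exact: h1|exact: h2].
Qed.

Lemma orbit_dist_le d x y a b g : is_metric d -> G g ->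
  orbit_dist d x y a b <= d a (g x) + d b (g y).
Proof.
case=> dge _ _ _ Gg; apply: ge_inf; last by exists g => //; left.
by exists 0 => r [h _ [->|->]]; rewrite addr_ge0.
Qed.

Lemma orbit_distC d x y a b : orbit_dist d x y a b = orbit_dist d x y b a.
Proof.
by rewrite /orbit_dist; congr inf; apply/seteqP; split=> r [g Gg [->|->]];
  exists g => //; [right|left|right|left].
Qed.

Lemma orbit_dist_le_id d x y a b : is_metric d ->
  orbit_dist d x y a b <= d a x + d b y.
Proof. by move=> dm; exact: (@orbit_dist_le d x y a b id). Qed.

Lemma orbit_dist_ge0 d x y a b : is_metric d -> 0 <= orbit_dist d x y a b.
Proof. by case=> dge _ _ _; apply: le_orbit_dist => g _; rewrite addr_ge0. Qed.

Lemma orbit_dist_lt d x y a b e : orbit_dist d x y a b < e ->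
  exists2 g, G g & d a (g x) + d b (g y) < e \/ d b (g x) + d a (g y) < e.
Proof.
move=> /inf_lt []; first by exists (d a x + d b y), id => //; left.
by move=> r [g Gg [->|->] re]; exists g => //; [left|right].
Qed.

Lemma orbit_dist_mono d d' x y a b : is_metric d ->
  (forall u v, d u v <= d' u v) ->
  orbit_dist d x y a b <= orbit_dist d' x y a b.
Proof.
move=> dm dd'; apply: le_orbit_dist => g Gg; last rewrite orbit_distC.
  by apply: le_trans (orbit_dist_le x y a b dm Gg) _; rewrite lerD.
by apply: le_trans (orbit_dist_le x y b a dm Gg) _; rewrite lerD.
Qed.

Lemma orbit_dist_lipschitz d x y a b a' b' : is_metric d ->
  orbit_dist d x y a b <= d a a' + d b b' + orbit_dist d x y a' b'.
Proof.
move=> dm; have [_ _ _ dT] := dm.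
rewrite -lerBlDl; apply: le_orbit_dist => g Gg; last rewrite orbit_distC.
  have := orbit_dist_le x y a b dm Gg.
  by have := dT a a' (g x); have := dT b b' (g y); lra.
have := orbit_dist_le x y b a dm Gg.
by have := dT a a' (g y); have := dT b b' (g x); lra.
Qed.

Lemma orbit_dist_invariant d x y a b h : invariant_metric d -> G h ->
  orbit_dist d x y (h a) (h b) = orbit_dist d x y a b.
Proof.
suff le h' a' b' : invariant_metric d -> G h' ->
    orbit_dist d x y (h' a') (h' b') <= orbit_dist d x y a' b'.
  move=> di Gh; apply/le_anti; rewrite le//=.
  have [k Gk [hk _]] := G_inv Gh.
  by have := le k (h a) (h b) di Gk; rewrite !hk.
move=> [dm dG] Gh'; apply: le_orbit_dist => g Gg; last rewrite orbit_distC.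
  have := orbit_dist_le x y (h' a') (h' b') dm (G_comp Gh' Gg).
  by rewrite /= !dG.
have := orbit_dist_le x y (h' b') (h' a') dm (G_comp Gh' Gg).
by rewrite /= !dG.
Qed.

(** An invariant [d] is constant on the orbit and varies by at most the sum of the displacements of
    the two points. This later keeps the bump away from the diagonal. *)
Lemma le_dist_orbit_dist d x y a b : invariant_metric d ->
  d x y <= d a b + orbit_dist d x y a b.
Proof.
move=> [dm dG]; have [_ _ dC dT] := dm.
rewrite -lerBlDl; apply: le_orbit_dist => g Gg; rewrite -(dG g Gg x y).
  have := metric_quad (g x) (g y) a b dm.
  by rewrite (dC (g x) a) (dC (g y) b); lra.
have := metric_quad (g x) (g y) b a dm.
by rewrite (dC (g x) b) (dC (g y) a) (dC b a); lra.
Qed.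

(** The inverse of the element of [G] that gives a nearly closest orbit point moves that point back
    to [{x, y}] and preserves the orbit distance. The factor 2 is slack for an infimum that may not
    be attained. *)
Lemma orbit_dist_near d x y a b : invariant_metric d ->
  0 < orbit_dist d x y a b -> exists a' b',
    orbit_dist d x y a' b' = orbit_dist d x y a b /\
    d x a' + d y b' < 2 * orbit_dist d x y a b.
Proof.
move=> di Q0; have [[_ _ dC _] dG] := di.
have /orbit_dist_lt [g Gg] :
  orbit_dist d x y a b < 2 * orbit_dist d x y a b by lra.
have [k Gk [gk kg]] := G_inv Gg => lt2; case: lt2 => lt2.
  exists (k a), (k b); split; first exact: orbit_dist_invariant.
  by rewrite -(dG g Gg x) -(dG g Gg y) !kg (dC (g x)) (dC (g y)).
exists (k b), (k a); split.
  by rewrite orbit_dist_invariant// orbit_distC.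
by rewrite -(dG g Gg x) -(dG g Gg y) !kg (dC (g x)) (dC (g y)).
Qed.

(** Orbit points tend to [{a, b}] for [d], hence for [f], and [f] equals [f x y] at all of them. *)
Lemma orbit_dist0_eq d f x y a b : is_metric d -> invariant_metric f ->
  metric_continuous d f -> orbit_dist d x y a b = 0 -> f a b = f x y.
Proof.
move=> [dge _ _ _] [fm fG] fc Q0; have [_ _ fC _] := fm.
have close (e : R) (e0 : 0 < e) : `|f a b - f x y| <= e.
  have e2 : 0 < e / 2 by lra.
  have [r r0 ar] := fc a _ e2; have [s s0 bs] := fc b _ e2.
  have /orbit_dist_lt [g Gg] : orbit_dist d x y a b < Num.min r s.
    by rewrite Q0 lt_min r0.
  rewrite !lt_min => near; rewrite -(fG g Gg x y) ler_norml.
  case: near => /andP[lr ls].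
    have /ar ha : d a (g x) < r by have := dge b (g y); lra.
    have /bs hb : d b (g y) < s by have := dge a (g x); lra.
    have := metric_quad a b (g x) (g y) fm.
    have := metric_quad (g x) (g y) a b fm.
    by rewrite (fC (g x) a) (fC (g y) b); lra.
  have /ar ha : d a (g y) < r by have := dge b (g x); lra.
  have /bs hb : d b (g x) < s by have := dge a (g y); lra.
  have := metric_quad a b (g y) (g x) fm.
  have := metric_quad (g x) (g y) b a fm.
  by rewrite (fC (g x) b) (fC (g y) a) (fC b a) (fC (g y) (g x)); lra.
apply/eqP; rewrite -subr_eq0 -normr_le0; apply/ler_addgt0Pr => e e0.
by rewrite add0r close.
Qed.

(** * Admissible metrics and their perturbation by a bump *)

Section Perturbation.
Variable d0 : X -> X -> R.
Hypothesis d0_inv : invariant_metric d0.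

(** The lower bound preserves properness and keeps the topology from getting coarser; continuity
    keeps it from getting finer. *)
Definition admissible d : Prop :=
  [/\ invariant_metric d, forall x y, d0 x y <= d x y
    & metric_continuous d0 d].

(* The term [Num.min e (6 * d a b)] gives the room in the triangle inequality
   that the bump needs: it is saturated wherever the bump is nonzero. *)
Definition perturb (e : R) x y d a b : R :=
  d a b + Num.min e (6 * d a b) + Num.max 0 (e - 6 * orbit_dist d x y a b).

Lemma le_perturb e x y d a b : is_metric d -> 0 < e ->
  d a b <= perturb e x y d a b.
Proof.
move=> [dge _ _ _] e0; rewrite /perturb; have := dge a b.
case: (leP e (6 * d a b)); case: (leP 0 (e - 6 * orbit_dist d x y a b)); lra.
Qed.

Lemma perturb_le e x y d a b : is_metric d -> 0 < e ->
  perturb e x y d a b <= d a b + 2 * e.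
Proof.
move=> dm e0; rewrite /perturb; have := orbit_dist_ge0 x y a b dm.
case: (leP e (6 * d a b)); case: (leP 0 (e - 6 * orbit_dist d x y a b)); lra.
Qed.

(** The orbit distance of [(a, b)] is at least [e / 2 - e / 3 = e / 6], so the bump vanishes
    there. *)
Lemma perturb_small e x y d a b : invariant_metric d -> 0 < e ->
  e <= 2 * d x y -> d a b <= e / 3 -> perturb e x y d a b <= 7 * d a b.
Proof.
move=> di e0 exy dab; rewrite /perturb.
have := le_dist_orbit_dist x y a b di.
case: (leP e (6 * d a b)); case: (leP 0 (e - 6 * orbit_dist d x y a b)); lra.
Qed.

Lemma perturb_metric e x y d : invariant_metric d -> 0 < e ->
  e <= 2 * d x y -> is_metric (perturb e x y d).
Proof.
move=> di e0 exy; have [dm _] := di; have [dge d0P dC dT] := dm; split.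
- by move=> a b; apply: le_trans (le_perturb x y a b dm e0).
- move=> a b; split => [p0|<-].
    by apply/d0P/le_anti; rewrite dge andbT -p0 le_perturb.
  have daa : d a a = 0 by exact: metric0.
  apply/le_anti/andP; split.
    by have := @perturb_small e x y d a a di e0 exy; rewrite daa; lra.
  by apply: le_trans (le_perturb x y a a dm e0).
- by move=> a b; rewrite /perturb dC orbit_distC.
(* If both minima on the right equal [e], they cover the minimum and the bump on the left. If just
   one does, the other, [6 * d], covers the change of the bump, which is 6-Lipschitz. If neither
   does, [d a c < e / 3] and the bump vanishes at [(a, c)]. *)
- move=> a b c; rewrite /perturb.
  have := dT a b c; have := dge a b; have := dge b c.
  have := orbit_dist_lipschitz x y a b a c dm.
  have := orbit_dist_lipschitz x y b c a c dm.
  have := le_dist_orbit_dist x y a c di; have := orbit_dist_ge0 x y a c dm.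
  rewrite (metric0 a dm) (metric0 c dm) (dC b a).
  case: (leP e (6 * d a b)); case: (leP e (6 * d b c));
  case: (leP e (6 * d a c));
  case: (leP 0 (e - 6 * orbit_dist d x y a b));
  case: (leP 0 (e - 6 * orbit_dist d x y b c));
  case: (leP 0 (e - 6 * orbit_dist d x y a c)); lra.
Qed.

Lemma perturb_admissible e x y d : admissible d -> 0 < e ->
  e <= 2 * d x y -> admissible (perturb e x y d).
Proof.
move=> [di le_d0 dc] e0 exy; have [dm dG] := di; split.
- split; first exact: perturb_metric.
  by move=> g Gg a b; rewrite /perturb dG// orbit_dist_invariant.
- by move=> a b; apply: le_trans (le_perturb x y a b dm e0).
- move=> a r r0.
  (* Below [e / 3] the perturbed metric is at most [7 * d], and [7 * (r / 8) < r]. *)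
  have m0 : 0 < Num.min (e / 3) (r / 8) by rewrite lt_min; apply/andP; lra.
  have [s s0 ds] := dc a _ m0.
  exists s => // b /ds; rewrite lt_min => /andP[h1 h2].
  by apply: le_lt_trans (perturb_small di e0 exy (ltW h1)) _; lra.
Qed.

Lemma orbit_dist_self d x y : is_metric d -> orbit_dist d x y x y = 0.
Proof.
move=> dm; apply/le_anti; rewrite orbit_dist_ge0// andbT.
by have := orbit_dist_le_id x y x y dm; rewrite !metric0// addr0.
Qed.

Lemma perturb_peak e x y d : is_metric d -> 0 < e -> e <= 2 * d x y ->
  perturb e x y d x y = d x y + 2 * e.
Proof.
move=> dm e0 exy; rewrite /perturb orbit_dist_self// mulr0 subr0.
by case: (leP e (6 * d x y)); case: (leP 0 e); lra.
Qed.

Lemma perturb_far e x y d a b : e <= 6 * orbit_dist d x y a b ->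
  perturb e x y d a b <= d a b + e.
Proof.
move=> eQ; rewrite /perturb.
case: (leP e (6 * d a b)); case: (leP 0 (e - 6 * orbit_dist d x y a b)); lra.
Qed.

(** * Conditions enforced by small perturbations *)

Definition near_metric d (c : R) d' : Prop :=
  forall a b, d a b <= d' a b <= d a b + c.

(** If [d] takes equal values at the two pairs, a bump of size [m] at [(x, y)] adds [2 * m] there
    and at most [m] at [(a, b)]. *)
Lemma separate_pairs d e x y a b : admissible d -> 0 < e -> x <> y ->
  0 < orbit_dist d0 x y a b ->
  exists d', [/\ admissible d', near_metric d e d' &
    exists2 c, 0 < c &
      forall d'', near_metric d' c d'' -> d'' x y <> d'' a b].
Proof.
move=> da e0 xy Q0; have [di le_d0 _] := da; have [dm _] := di.
case: (eqVneq (d x y) (d a b)) => [dxy|dne]; last first.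
  exists d; split=> //; first by move=> u v; rewrite lexx lerDl ltW.
  exists (`|d x y - d a b| / 2).
    by rewrite divr_gt0// normr_gt0 subr_eq0.
  move=> d'' near eq''; have := near x y; have := near a b; rewrite eq''.
  move: dne; rewrite neq_lt => /orP[?|?].
    by rewrite ltr0_norm; lra.
  by rewrite gtr0_norm; lra.
have xy0 := metric_gt0 dm xy.
have Qd : 0 < orbit_dist d x y a b.
  by apply: lt_le_trans Q0 _; apply: orbit_dist_mono => //; case: d0_inv.
pose m := Num.min (e / 2) (Num.min (d x y) (orbit_dist d x y a b)).
have m0 : 0 < m by rewrite !lt_min xy0 Qd divr_gt0.
have [me [mxy mQ]] : m <= e / 2 /\ (m <= d x y /\ m <= orbit_dist d x y a b).
  by have := lexx m; rewrite {2}/m !le_min => /and3P[].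
exists (perturb m x y d); split.
- by apply: perturb_admissible => //; lra.
- move=> u v; rewrite le_perturb//=.
  by apply: le_trans (perturb_le x y u v dm m0) _; lra.
- exists (m / 2); first by lra.
  move=> d'' near eq''; have := near x y; have := near a b.
  have := @perturb_far m x y d a b; rewrite perturb_peak// ?eq''; lra.
Qed.

Definition isometric_map d (u : X -> X) := forall a b, d (u a) (u b) = d a b.

(* With [q] the distance of a nearby pair [(a, b)] from the orbit, the bump drops
   by [6 * q] from [(x, y)] to [(a, b)] while [d] varies by at most [2 * q]; if
   [(u x, u y)] is far from the orbit, then the perturbed metric varies by only
   about [2 * q] from [(u x, u y)] to [(u a, u b)]. *)
Lemma pin_orbit d e r x y : admissible d -> 0 < e -> 0 < r -> x <> y ->
  (forall s, 0 < s -> exists a b,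
     [/\ d0 x a < s, d0 y b < s & 0 < orbit_dist d0 x y a b]) ->
  exists d', [/\ admissible d', near_metric d e d' &
    exists2 c, 0 < c &
      forall d'' u, near_metric d' c d'' -> isometric_map d'' u ->
        orbit_dist d0 x y (u x) (u y) < r].
Proof.
move=> da e0 r0 xy nonisolated; have [di le_d0 dc] := da.
have [dm _] := di; have [dge _ dC dT] := dm; have [d0m _] := d0_inv.
have xy0 := metric_gt0 dm xy.
pose m := Num.min (e / 2) (Num.min (d x y) r).
have m0 : 0 < m by rewrite !lt_min xy0 r0 divr_gt0.
have [me [mxy mr]] : m <= e / 2 /\ (m <= d x y /\ m <= r).
  by have := lexx m; rewrite {2}/m !le_min => /and3P[].
have [a [b [Q0 Qm ab]]] : exists a b, [/\ 0 < orbit_dist d x y a b,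
    orbit_dist d x y a b <= m / 50
    & d x a + d y b < 2 * orbit_dist d x y a b].
  have m100 : 0 < m / 100 by lra.
  have [s s0 xs] := dc x _ m100; have [t t0 yt] := dc y _ m100.
  have [|a [b [xa yb Q0]]] := nonisolated (Num.min s t).
    by rewrite lt_min s0.
  move: xa yb; rewrite !lt_min => /andP[/xs xa _] /andP[_ /yt yb].
  have Qd : 0 < orbit_dist d x y a b.
    by apply: lt_le_trans Q0 _; exact: orbit_dist_mono.
  have [a' [b' [Q' lt']]] := orbit_dist_near di Qd.
  exists a', b'; rewrite Q'; split=> //.
  by have := orbit_dist_le_id x y a b dm; rewrite (dC a) (dC b); lra.
pose q := orbit_dist d x y a b.
have exy : m <= 2 * d x y by lra.
have pm := perturb_metric di m0 exy.
exists (perturb m x y d); split.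
- exact: perturb_admissible.
- move=> u v; rewrite le_perturb//=.
  by apply: le_trans (perturb_le x y u v dm m0) _; lra.
exists (q / 10); first by rewrite divr_gt0.
move=> d'' u near iso; rewrite ltNge; apply/negP => far.
have far_d : r <= orbit_dist d x y (u x) (u y).
  by apply: le_trans far _; exact: orbit_dist_mono.
(* At this scale the perturbed metric is at most [7 * d] at [(v, w)] and, since [q <= m / 50], at
   least [7 * d] at the images; the tolerance [q / 10] gets divided by 7. *)
have move_le v w : d v w <= 2 * q -> d (u v) (u w) <= d v w + q / 70.
  move=> vw.
  have := near v w; have := near (u v) (u w); rewrite iso.
  have := @perturb_small m x y d v w di m0 exy.
  rewrite {2}/perturb; have := dge (u v) (u w).
  case: (leP m (6 * d (u v) (u w)));
  case: (leP 0 (m - 6 * orbit_dist d x y (u v) (u w)));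
  rewrite -/q in Qm Q0 *; lra.
have xa : d (u x) (u a) <= d x a + q / 70.
  by apply: move_le; have := dge y b; rewrite -/q in ab; lra.
have yb : d (u y) (u b) <= d y b + q / 70.
  by apply: move_le; have := dge x a; rewrite -/q in ab; lra.
(* From [(x, y)] to [(a, b)], [d''] drops by more than [6 * q - 2 * q - q / 10]; between the images
   it drops by less than [2 * q + 2 * (q / 70) + q / 10]. *)
have := near x y; have := near a b.
have := near (u x) (u y); have := near (u a) (u b); rewrite !iso.
rewrite perturb_peak//.
have := @perturb_far m x y d (u x) (u y).
have := metric_quad a b x y dm; have := metric_quad (u x) (u y) (u a) (u b) dm.
rewrite (dC a x) (dC b y) /perturb.
rewrite -/q in Qm Q0 ab *.
case: (leP m (6 * d a b)); case: (leP 0 (m - 6 * q));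
case: (leP m (6 * d (u a) (u b)));
case: (leP 0 (m - 6 * orbit_dist d x y (u a) (u b))); lra.
Qed.

(** * Uniform limits and Baire category *)

(** All properties pass to uniform limits directly except definiteness, which is inherited from the
    lower bound [d0]. *)
Lemma admissible_limit d :
  (forall e, 0 < e -> exists2 d', admissible d' & near_metric d' e d) ->
  admissible d.
Proof.
move=> lim.
have le_d0 a b : d0 a b <= d a b.
  have [d' [_ le' _] near] := lim 1 ltr01.
  by apply: le_trans (le' a b) _; have /andP[] := near a b.
have [[d0ge d0P _ _] _] := d0_inv.
have approx (r t : R) : (forall e : R, 0 < e -> r <= t + e) -> r <= t.
  by move=> h; apply/ler_addgt0Pr => e; exact: h.
split=> //; last first.
  move=> x e e0; have e2 : 0 < e / 2 by lra.
  have [d' [_ _ dc'] near] := lim _ e2; have [r r0 xr] := dc' x _ e2.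
  by exists r => // y /xr; have := near x y; lra.
split; first split.
- by move=> a b; apply: le_trans (le_d0 a b).
- move=> a b; split=> [d_ab|<-].
    by apply/d0P/le_anti; rewrite d0ge andbT -d_ab.
  apply/le_anti; rewrite (le_trans (d0ge a a))// andbT.
  apply: approx => e e0; have [d' [[dm' _] _ _] near] := lim _ e0.
  by have := near a a; rewrite (metric0 a dm'); lra.
- move=> a b; apply/le_anti/andP; split; apply: approx => e e0;
    have [d' [[[_ _ dC' _] _] _ _] near] := lim _ e0;
    by have := near a b; have := near b a; rewrite (dC' a); lra.
- move=> a b c; apply: approx => e e0.
  have [d' [[[_ _ _ dT'] _] _ _] near] := lim _ e0.
  have := dT' a b c; have := near a b; have := near b c; have := near a c; lra.
- move=> g Gg a b; apply/le_anti/andP; split; apply: approx => e e0;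
    have [d' [[_ dG'] _ _] near] := lim _ e0;
    by have := near a b; have := near (g a) (g b); rewrite (dG' g Gg); lra.
Qed.

(* Baire category for the neighbourhoods [{d' | near_metric d c d'}]: the limit
   of an increasing sequence of metrics stays in all of them. *)
Lemma generic_metric (I : countType) (P : I -> (X -> X -> R) -> Prop) d :
  admissible d ->
  (forall i d e, admissible d -> 0 < e ->
    exists d', [/\ admissible d', near_metric d e d' &
      exists2 c, 0 < c & forall d'', near_metric d' c d'' -> P i d'']) ->
  exists2 d', admissible d' & forall i, P i d'.
Proof.
move=> da dense_P.
(* A state holds the stage, the current metric and the radius of its neighbourhood. Stage [n]
   enforces the condition with code [n], if there is one. *)
pose state := (nat * ((X -> X -> R) * R))%type.
pose ok (s : state) := admissible s.2.1 /\ 0 < s.2.2.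
pose step (s t : state) := [/\ t.1 = s.1.+1,
  forall f, near_metric t.2.1 t.2.2 f -> near_metric s.2.1 s.2.2 f,
  t.2.2 <= s.2.2 / 2 &
  forall i, unpickle s.1 = Some i ->
    forall f, near_metric t.2.1 t.2.2 f -> P i f].
have next (s : {s | ok s}) : {t : {s | ok s} | step (sval s) (sval t)}.
  apply: cid; case: s => -[n [f c]] /= [/= fa c0].
  have c2 : 0 < c / 2 by lra.
  have [f' [fa' near' [c' c'0 Pc']]] : exists f', [/\ admissible f',
      near_metric f (c / 2) f' & exists2 c', 0 < c' & forall i,
        unpickle n = Some i -> forall g, near_metric f' c' g -> P i g].
    case: (unpickle n) => [i|].
      have [f' [fa' near' [c' c'0 Pc']]] := dense_P i f _ fa c2.
      by exists f'; split=> //; exists c' => // _ [<-].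
    exists f; split=> //; first by move=> a b; rewrite lexx lerDl ltW.
    by exists 1.
  pose m := Num.min (c / 2) c'.
  have m0 : 0 < m by rewrite lt_min c2.
  have [mc mc'] : m <= c / 2 /\ m <= c'.
    by have := lexx m; rewrite {2}/m le_min => /andP[].
  have okm : ok (n.+1, (f', m)) by [].
  exists (exist _ _ okm); split=> //=.
  - by move=> g near a b; have := near a b; have := near' a b; lra.
  - move=> i ni g near; apply: (Pc' i ni) => a b.
    by have := near a b; lra.
have ok0 : ok (0%N, (d, 1)) by split.
have [s [s0 sS]] := dependent_choice next (exist _ _ ok0).
pose D n := (sval (s n)).2.1; pose c n := (sval (s n)).2.2.
have sn n : (sval (s n)).1 = n.
  by elim: n => [|n IHn]; [rewrite s0|have [-> _ _ _] := sS n; rewrite IHn].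
have Da n : admissible (D n) by have [] := svalP (s n).
have c0 n : 0 < c n by have [] := svalP (s n).
have near_mono n k f :
    near_metric (D (n + k)%N) (c (n + k)%N) f -> near_metric (D n) (c n) f.
  elim: k => [|k IHk]; first by rewrite addn0.
  by rewrite addnS => near; apply: IHk; have [_ + _ _] := sS (n + k)%N; apply.
have D_le m n a b : D m a b <= D n a b + c n.
  have near_self k : near_metric (D k) (c k) (D k).
    by move=> u v; rewrite lexx lerDl ltW.
  case/orP: (leq_total n m) => /subnKC mn.
    have : near_metric (D n) (c n) (D m).
      by apply: (@near_mono n (m - n)%N); rewrite mn; exact: near_self.
    by move=> /(_ a b)/andP[].
  have : near_metric (D m) (c m) (D n).
    by apply: (@near_mono m (n - m)%N); rewrite mn; exact: near_self.
  by move=> /(_ a b); have := c0 n; lra.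
pose L a b := sup (range (fun n => D n a b)).
have L_near n : near_metric (D n) (c n) L.
  move=> a b; apply/andP; split.
    apply: ub_le_sup; last by exists n.
    by exists (D n a b + c n) => _ [m _ <-].
  apply: ge_sup; first by exists (D n a b), n.
  by move=> _ [m _ <-].
exists L.
  apply: admissible_limit => e e0.
  have c_le n : c n <= 2 ^- n.
    elim: n => [|n IHn]; first by rewrite /c s0 expr0 invr1.
    have [_ _ h _] := sS n; apply: le_trans h _; rewrite exprSr invfM.
    by apply: ler_wpM2r => //; lra.
  have [n ne] : exists n, c n < e.
    exists (Num.bound e^-1); apply: le_lt_trans (c_le _) _.
    by rewrite invf_plt ?posrE ?exprn_gt0//; exact: upper_nthrootP.
  exists (D n) => // a b; have := L_near n a b; lra.
move=> i; have [_ _ _ +] := sS (pickle i); rewrite sn => /(_ i).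
by apply; [exact: pickleK|exact: L_near].
Qed.

(** * A metric whose isometries preserve all the given metrics *)

(** The countably many generic conditions mention only orbits and not [f], so one [d] serves all [f]
    at once. *)
Lemma rigid_metric (s : nat -> X) :
  (forall x e, 0 < e -> exists n, d0 x (s n) < e) ->
  exists2 d, admissible d &
    forall u v, cancel u v -> cancel v u -> isometric_map d u ->
    forall f, invariant_metric f -> metric_continuous d0 f ->
    isometric_map f u.
Proof.
move=> s_dense; have [d0m _] := d0_inv.
pose nonisolated x y := forall r, 0 < r -> exists a b,
  [/\ d0 x a < r, d0 y b < r & 0 < orbit_dist d0 x y a b].
pose I := ((nat * nat * nat) + (nat * nat * nat * nat))%type.
pose P (i : I) d := match i with
  | inl (i, j, k) => s i <> s j -> nonisolated (s i) (s j) ->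
      forall u, isometric_map d u ->
        orbit_dist d0 (s i) (s j) (u (s i)) (u (s j)) < k.+1%:R^-1
  | inr (i, j, k, l) => s i <> s j ->
      0 < orbit_dist d0 (s i) (s j) (s k) (s l) ->
      d (s i) (s j) <> d (s k) (s l)
  end.
have d0a : admissible d0.
  by split=> // x e e0; exists e.
have trivial_step d e : admissible d -> 0 < e ->
    [/\ admissible d, near_metric d e d & exists2 c : R, 0 < c & True].
  move=> da e0; split=> //; last by exists 1.
  by move=> a b; rewrite lexx lerDl ltW.
have [|d da Pd] := @generic_metric I P d0 d0a.
  move=> [[[i j] k]|[[[i j] k] l]] d e da e0.
    have [h|h] := pselect (s i <> s j /\ nonisolated (s i) (s j)); last first.
      have [? ? [c c0 _]] := trivial_step d e da e0.
      by exists d; split=> //; exists c => // d'' _ ? ?; case: h.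
    have [ij iso] := h; have k0 : 0 < k.+1%:R^-1 :> R by rewrite invr_gt0.
    have [d' [da' near [c c0 hc]]] := pin_orbit da e0 k0 ij iso.
    by exists d'; split=> //; exists c => // d'' near'' _ _ u; exact: hc.
  have [[ij Q0]|h] := pselect (s i <> s j /\
      0 < orbit_dist d0 (s i) (s j) (s k) (s l)); last first.
    have [? ? [c c0 _]] := trivial_step d e da e0.
    by exists d; split=> //; exists c => // d'' _ ? ?; case: h.
  have [d' [da' near [c c0 hc]]] := separate_pairs da e0 ij Q0.
  by exists d'; split=> //; exists c => // d'' near'' _ _; exact: hc.
exists d => // u v uv vu iso_u f fi fc.
have [di le_d0 dc] := da; have [dm _] := di; have [fm _] := fi.
have [_ _ dC _] := dm; have [_ _ fC _] := fm.
have near_s x r e : 0 < r -> 0 < e -> exists n, d x (s n) < r /\ f x (s n) < e.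
  move=> r0 e0; have [r1 r10 xr] := dc x _ r0; have [r2 r20 xe] := fc x _ e0.
  have [|n] := s_dense x (Num.min r1 r2); first by rewrite lt_min r10.
  by rewrite lt_min => /andP[/xr ? /xe ?]; exists n.
have approx (r t : R) : (forall e : R, 0 < e -> `|r - t| <= e) -> r = t.
  move=> h; apply/eqP; rewrite -subr_eq0 -normr_le0; apply/ler_addgt0Pr => e e0.
  by rewrite add0r h.
have iso_s i j : f (u (s i)) (u (s j)) = f (s i) (s j).
  have [->|ij] := pselect (s i = s j); first by rewrite !metric0.
  have [iso|/existsNP[r /not_implyP[r0 isolated]]] :=
      pselect (nonisolated (s i) (s j)).
    apply: (orbit_dist0_eq d0m fi fc).
    apply/le_anti; rewrite orbit_dist_ge0// andbT; apply/ler_addgt0Pr => e e0.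
    have [k] := ltr_add_invr e0; rewrite !add0r => ke.
    exact/ltW/(lt_trans (Pd (inl (i, j, k)) ij iso u iso_u) ke).
  apply: approx => e e0; have e2 : 0 < e / 2 by lra.
  (* Closeness within the isolation radius [r] for [d] is transported back by [v]; closeness for [f]
     serves the final estimate. *)
  have [k [dk fk]] := near_s (u (s i)) r _ r0 e2.
  have [l [dl fl]] := near_s (u (s j)) r _ r0 e2.
  have Q0 : orbit_dist d0 (s i) (s j) (v (s k)) (v (s l)) = 0.
    apply/le_anti; rewrite orbit_dist_ge0// andbT leNgt; apply/negP => Q0.
    apply: isolated; exists (v (s k)), (v (s l)); split=> //.
      by apply: le_lt_trans (le_d0 _ _) _; rewrite -iso_u vu.
    by apply: le_lt_trans (le_d0 _ _) _; rewrite -iso_u vu.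
  have deq : d (s i) (s j) = d (s k) (s l).
    rewrite -(orbit_dist0_eq d0m di dc Q0).
    by rewrite -iso_u !vu.
  have Qkl : orbit_dist d0 (s i) (s j) (s k) (s l) = 0.
    apply/le_anti; rewrite orbit_dist_ge0// andbT leNgt; apply/negP => Qkl.
    exact: (Pd (inr (i, j, k, l)) ij Qkl).
  rewrite -(orbit_dist0_eq d0m fi fc Qkl) ler_norml.
  have := metric_quad (u (s i)) (u (s j)) (s k) (s l) fm.
  have := metric_quad (s k) (s l) (u (s i)) (u (s j)) fm.
  by rewrite (fC (s k) (u (s i))) (fC (s l) (u (s j))); lra.
(* Extension from the dense sequence: four replacements of a point, two before and two after
   applying [u], cost [e / 4] each. *)
move=> x y; apply: approx => e e0; have e4 : 0 < e / 4 by lra.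
have near_us z : exists n, f z (s n) < e / 4 /\ f (u z) (u (s n)) < e / 4.
  have [r r0 zr] := fc (u z) _ e4; have [n [dn fn]] := near_s z r _ r0 e4.
  exists n; split=> //; apply: zr; apply: le_lt_trans (le_d0 _ _) _.
  by rewrite iso_u.
have [i [xi uxi]] := near_us x; have [j [yj uyj]] := near_us y.
rewrite ler_norml.
have := metric_quad (u x) (u y) (u (s i)) (u (s j)) fm.
have := metric_quad (u (s i)) (u (s j)) (u x) (u y) fm.
have := metric_quad x y (s i) (s j) fm.
have := metric_quad (s i) (s j) x y fm.
rewrite (fC (s i) x) (fC (s j) y) (fC (u (s i)) (u x)) (fC (u (s j)) (u y)).
rewrite iso_s; lra.
Qed.
End Perturbation.
End GroupAction.
End Metrics.

(** * Topology, properness and dense sequences *)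

Section Topology.
Set Implicit Arguments.
Unset Strict Implicit.
Variables (R : realType) (X : topologicalType).
Implicit Types d f : X -> X -> R.

Lemma open_metric_ball f x (e : R) : is_metric f -> induces_topology f ->
  open [set y | f x y < e].
Proof.
move=> [_ _ _ fT] find; apply/find => y /= xy; exists (e - f x y).
  by rewrite subr_gt0.
by move=> z /= yz; have := fT x y z; lra.
Qed.

Lemma induces_metric_continuous d f : is_metric f ->
  induces_topology d -> induces_topology f -> metric_continuous d f.
Proof.
move=> fm dind find x e e0.
have := open_metric_ball x e fm find.
move=> /dind /(_ x) /=; rewrite (metric0 _ fm) => /(_ e0) [r r0 rs].
by exists r => // y; exact: rs.
Qed.

(** Closed balls of [d] are closed subsets of the compact balls of [d0]. *)
Lemma Metr_c_dominating d0 d : Metr_c R X d0 -> is_metric d ->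
  (forall x y, d0 x y <= d x y) -> metric_continuous d0 d -> Metr_c R X d.
Proof.
move=> [d0m d0ind d0proper] dm le_d0 dc.
have dind : induces_topology d.
  move=> U; split=> [/d0ind oU x /oU [e e0 eU]|oU].
    by exists e => // y; move=> /= xy; apply: eU => /=; exact: le_lt_trans xy.
  apply/d0ind => x /oU [e e0 eU]; have [r r0 re] := dc x e e0.
  by exists r => // y /= /re; exact: eU.
split=> // x r r0; apply: subclosed_compact (d0proper x r r0) _; last first.
  by move=> y /=; exact: le_trans.
have -> : [set y | d x y <= r] = ~` [set y | r < d x y].
  by apply/seteqP; split=> y /=; rewrite leNgt => /negP.
apply: open_closedC; apply/dind => y /= xy; exists (d x y - r).
  by rewrite subr_gt0.
move=> z /= yz; have [_ _ dC dT] := dm.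
by have := dT x z y; rewrite (dC z y); lra.
Qed.

Lemma separable_dense_seq d (x0 : X) : separable X -> is_metric d ->
  induces_topology d ->
  exists s : nat -> X, forall x e, 0 < e -> exists n, d x (s n) < e.
Proof.
move=> [S Scount Sdense] dm dind.
have hit x e : 0 < e -> exists2 y, S y & d x y < e.
  move=> e0; have [|y [xy Sy]] := Sdense _ _ (open_metric_ball x e dm dind).
    by exists x; rewrite /= metric0.
  by exists y.
(* The point [x0] excludes an empty [S], which no sequence enumerates. *)
have /pfcard_geP [S0|[s]] := Scount.
  by have [y] := hit x0 1 ltr01; rewrite S0.
exists s => x e /(hit x) [y Sy xy].
by have [n _ ny] := @surj _ _ _ _ s y Sy; exists n; rewrite ny.
Qed.

Lemma Iso_inverse d g : Iso d g ->
  exists2 h, Iso d h & cancel g h /\ cancel h g.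
Proof.
move=> [[h gh hg] iso]; exists h => //; split; first by exists g.
by move=> x y; rewrite -iso !hg.
Qed.

End Topology.

(** * Intersections of isometry groups *)

Theorem corollary1p8 (R : realType) (X : topologicalType)
    (X_lc : locally_compact [set: X]) (X_polish : polish R X)
    (F : set (set (X -> X)))
    (F_sub : F `<=` Iso_groups R X) (F_neq0 : F !=set0) :
  Iso_groups R X (\bigcap_(G in F) G).
Proof.
have [G0 FG0] := F_neq0; have [d0 d0X G0E] := F_sub _ FG0.
have [d0m d0ind _] := d0X.
(* On an empty space preservation of distances is vacuous, so all the groups coincide and [d0] is a
   witness. *)
have [[x0 _]|X0] := pselect (exists x : X, True); last first.
  exists d0 => //; apply/seteqP; split=> g; last by move/(_ _ FG0); rewrite G0E.
  move=> [g_bij _] G /F_sub[d _ <-]; split=> // x.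
  by case: X0; exists x.
set G := \bigcap_(G in F) G.
have GP g : G g <-> forall H (d : X -> X -> R), F H -> H = Iso d -> Iso d g.
  split=> [Gg H d FH <-|h H FH]; first exact: Gg.
  by have [d _ HE] := F_sub _ FH; rewrite -HE; exact: (h H d FH (esym HE)).
have G_id : G id by apply/GP => H d _ _; split=> //; exists id.
have G_comp g h : G g -> G h -> G (g \o h).
  move=> /GP Gg /GP Gh; apply/GP => H d FH HE.
  have [gb gi] := Gg H d FH HE; have [hb hi] := Gh H d FH HE.
  by split=> [|x y]; [exact: bij_comp|rewrite /= gi hi].
have G_inv g : G g -> exists2 h, G h & cancel g h /\ cancel h g.
  move=> Gg; have [|h _ [gh hg]] := @Iso_inverse R X d0 g.
    by rewrite G0E; exact: Gg.
  exists h => //; apply/GP => H d FH HE.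
  have /GP/(_ _ _ FH HE)/Iso_inverse [k kI [gk kg]] := Gg.
  (* Inverse maps are unique, so the inverse found for [d0] lies in every group of the family. *)
  suff -> : h = k by [].
  by apply/funext => x; rewrite -[LHS]gk hg.
have G_invariant H (d : X -> X -> R) : F H -> Iso d = H -> is_metric d -> invariant_metric G d.
  move=> FH HE dm; split=> // g /GP /(_ H d FH (esym HE)) [_]; exact.
have d0_inv := G_invariant _ _ FG0 G0E d0m.
have [s s_dense] := separable_dense_seq x0 X_polish.1 d0m d0ind.
have [d [[dm dG] le_d0 dc] rigid] :=
  rigid_metric G_id G_comp G_inv d0_inv s_dense.
exists d; first exact: Metr_c_dominating d0X dm le_d0 dc.
apply/seteqP; split=> [u [[v uv vu] iso] H FH|g Gg].
  have [f [fm find _] fE] := F_sub _ FH; rewrite -fE.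
  split; first by exists v.
  apply: (rigid u v uv vu iso); first exact: (G_invariant H).
  exact: induces_metric_continuous.
split; last by move=> x y; exact: dG.
by have [h _ [gh hg]] := G_inv g Gg; exists h.
Qed.
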